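(* Let $(\Omega,\mathcal{B},P)$ be a probability space with $\mathcal{B}$ countably generated, let $\mathcal{A}\subset\mathcal{B}$ be a sub-$\sigma$-field, and let $\mu$ be a fixed regular conditional distribution for $P$ given $\mathcal{A}$. Suppose that $H(\omega)\in\mathcal{B}$ for all $\omega\in\Omega$. Then for each $U\in\mathcal{A}$ such that the trace $\sigma$-field $\mathcal{A}\cap U$ is countably generated, there is $U_0\in\mathcal{A}$ with $U_0\subset U$, $P(U-U_0)=0$ and $f(\omega)=1$ for all $\omega\in U_0$. Moreover, if $S\in\mathcal{A}_P$, then the condition (3) there is $A_0\in\mathcal{A}$ with $P(A_0)=1$ and $\mu(\omega)(H(\omega))\in\{0,1\}$ for all $\omega\in A_0$ is equivalent to each of the following conditions (a) and (b): (a) $f_B$ is $\mathcal{A}_P$-measurable for all $B\in\mathcal{B}$; (b) $\mathcal{A}\cap U$ is countably generated for some $U\in\mathcal{A}$ with $U\subset S$ and $P(S-U)=0$.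
   Context: Let $\mathbb{P}$ be the set of probability measures on $\mathcal{B}$. A regular conditional distribution for $P$ given $\mathcal{A}$ is a map $\mu:\Omega\to\mathbb{P}$ such that, for all $B\in\mathcal{B}$, the function $\omega\mapsto\mu(\omega)(B)$ is a version of $E(I_B\mid\mathcal{A})$ (in particular it is $\mathcal{A}$-measurable). A $\sigma$-field is countably generated if it is generated by one of its countable subclasses. For $U\in\mathcal{A}$, $\mathcal{A}\cap U=\{A\cap U:A\in\mathcal{A}\}$ is the trace $\sigma$-field on $U$. $H(\omega)=\bigcap_{\omega\in A\in\mathcal{A}}A$ is the atom of $\mathcal{A}$ including $\omega$. $\mathcal{A}_P=\{A\subset\Omega:\exists A_1,A_2\in\mathcal{A}\text{ with }A_1\subset A\subset A_2\text{ and }P(A_2-A_1)=0\}$ is the completion of $\mathcal{A}$ with respect to $P|\mathcal{A}$; the only probability measure on $\mathcal{A}_P$ agreeing with $P$ on $\mathcal{A}$ is still denoted $P$. When $H(\omega)\in\mathcal{B}$ for all $\omega$, put $f_B(\omega)=\mu(\omega)(B\cap H(\omega))$ for $\omega\in\Omega$, $B\in\mathcal{B}$; $f=f_\Omega$; and $S=\{f>0\}=\{\omega\in\Omega:f(\omega)>0\}$. *)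

(* Defs.v *)
From HB Require Import structures.
From mathcomp Require Import all_boot all_order all_algebra.
From mathcomp Require Import all_classical all_reals all_analysis measurable_realfun.

Set Implicit Arguments.
Unset Strict Implicit.
Unset Printing Implicit Defensive.
Import Order.TTheory GRing.Theory Num.Theory.
Import numFieldNormedType.Exports.
Local Open Scope classical_set_scope.
Local Open Scope ring_scope.
Local Open Scope ereal_scope.

(* [F] is a class of subsets of [D], and the sigma-field it generates is taken
   on the space [D] (this matters for the trace sigma-fields). *)
Definition countably_generated (T : Type) (D : set T) (F : set (set T)) : Prop :=
  exists C : set (set T), [/\ countable C, C `<=` F & F = <<s D, C >>].

(* [g_sigma_algebraType F] carries the sigma-field [<<s F >>], which is [F]
   itself when [F] is a sigma-field on [T] (sigma_algebra_id). *)
Definition measurable_wrt (T : pointedType) (R : realType) (F : set (set T))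
    (g : T -> \bar R) : Prop :=
  measurable_fun [set: g_sigma_algebraType F]
    (g : g_sigma_algebraType F -> \bar R).

Definition cond_expectation_version (d : measure_display) (T : measurableType d)
    (R : realType) (P : probability T R) (F : set (set T))
    (Y Z : T -> \bar R) : Prop :=
  [/\ measurable_wrt F Z, P.-integrable setT Z &
      forall A, F A -> \int[P]_(w in A) Z w = \int[P]_(w in A) Y w].

Definition regular_cond_distribution (d : measure_display)
    (T : measurableType d) (R : realType) (P : probability T R)
    (F : set (set T)) (mu : T -> probability T R) : Prop :=
  forall B, measurable B ->
    cond_expectation_version P F (fun w => (\1_B w)%:E) (fun w => mu w B).

(* The atom of [F] including [w]; an arbitrary intersection, so it need not
   belong to [F], nor be measurable. *)
Definition atom (T : Type) (F : set (set T)) (w : T) : set T :=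
  \bigcap_(A in [set A | F A /\ A w]) A.

Definition completion (d : measure_display) (T : measurableType d)
    (R : realType) (P : probability T R) (F : set (set T)) : set (set T) :=
  [set A | exists A1 A2,
    [/\ F A1, F A2, A1 `<=` A, A `<=` A2 & P (A2 `\` A1) = 0]].

(* The probability on [completion P F] extending the restriction of [P] to [F]
   (see completion_probE).  Members of [completion P F] need not be measurable
   in [T], and [P] itself is meaningless on nonmeasurable sets. *)
Definition completion_prob (d : measure_display) (T : measurableType d)
    (R : realType) (P : probability T R) (F : set (set T)) (A : set T) : \bar R :=
  ereal_inf [set P A2 | A2 in [set A2 | F A2 /\ A `<=` A2]].

(* f_B *)
Definition atom_mass (d : measure_display) (T : measurableType d)
    (R : realType) (F : set (set T)) (mu : T -> probability T R)
    (B : set T) (w : T) : \bar R :=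
  mu w (B `&` atom F w).

(* S = {f > 0}, with f = f_Omega *)
Definition atom_support (d : measure_display) (T : measurableType d)
    (R : realType) (F : set (set T)) (mu : T -> probability T R) : set T :=
  [set w | 0 < atom_mass F mu setT w].

(* In particular, [measurable_wrt (completion P F)] is measurability with
   respect to [completion P F] itself. *)
Lemma completion_sigma_algebra (d : measure_display) (T : measurableType d)
    (R : realType) (P : probability T R) (F : set (set T)) :
  sigma_algebra setT F -> F `<=` measurable ->
  sigma_algebra setT (completion P F).
Proof.
move=> sF Fm; have [F0 FC FU] := sF; split.
- by exists set0, set0; split => //; rewrite setDv measure0.
- move=> A [A1 [A2 [FA1 FA2 A1A AA2 PA]]].
  exists (setT `\` A2), (setT `\` A1); split; [exact: FC|exact: FC| | |].
  + exact: setDS.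
  + exact: setDS.
  + rewrite !setTD setDE setCK; rewrite setIC -setDE; exact: PA.
- move=> A /choice[A1 /choice[A2 HA]].
  exists (\bigcup_i A1 i), (\bigcup_i A2 i); split.
  + by apply: FU => i; case: (HA i).
  + by apply: FU => i; case: (HA i).
  + by apply: subset_bigcup => i _; case: (HA i).
  + by apply: subset_bigcup => i _; case: (HA i).
  + apply/negligibleP.
      by apply: measurableD; apply: bigcup_measurable => i _;
        apply: Fm; case: (HA i).
    apply: (@negligibleS _ _ _ _ (\bigcup_i (A2 i `\` A1 i))).
      move=> x [[i _ A2x] nA1x]; exists i => //; split => // A1x.
      by apply: nA1x; exists i.
    apply: negligible_bigcup => i; apply/negligibleP; last by case: (HA i).
    by apply: measurableD; apply: Fm; case: (HA i).
Qed.

(* By monotonicity, [P A1] is the value at [A] of any measure on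
   [completion P F] agreeing with [P] on [F]; [A1 = A2 = A] gives agreement of
   [completion_prob P F] with [P] on [F]. *)
Lemma completion_probE (d : measure_display) (T : measurableType d)
    (R : realType) (P : probability T R) (F : set (set T)) (A A1 A2 : set T) :
  F `<=` measurable -> F A1 -> F A2 -> A1 `<=` A -> A `<=` A2 ->
  P (A2 `\` A1) = 0 -> completion_prob P F A = P A1.
Proof.
move=> Fm FA1 FA2 A1A AA2 PA; have [mA1 mA2] := (Fm _ FA1, Fm _ FA2).
apply/eqP; rewrite eq_le; apply/andP; split.
  have <- : P A2 = P A1.
    have A12 : A1 `<=` A2 by exact: subset_trans AA2.
    rewrite -(setDUK A12) measureU//; last 2 first.
    - exact: measurableD.
    - by rewrite setDIK.
    by rewrite -[X in X = _]/(P A1 + P (A2 `\` A1)) PA adde0.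
  by apply: ereal_inf_lbound; exists A2.
apply: le_ereal_inf_tmp => _ [C [FC AC] <-].
by apply: le_measure; rewrite ?inE//; [exact: Fm|exact: subset_trans AC].
Qed.

(* Main.v *)
(* If A is countably generated on U, say by a countable class C, then the atom
   of w in U is an intersection of countably many members D of A, namely the
   sets E and U - E for E in C that contain w, and U itself; each satisfies
   mu(w)(D) = 1 for almost every w in D, whence f = 1 almost surely on U.

   The equivalence goes around (3) => (a) => (b) => (3).  Under (3), f_B agrees
   almost surely with mu(.)(B) on S and vanishes off S.  For (a) => (b), take a
   countable pi-system G generating B and sandwich each of the countably many
   sets {f_B > q}, B in G, q rational, between two members of A differing by a
   null set.  Removing all these null sets leaves U in A on which the traces of
   the sets {f_B > q} belong to A; they generate the trace of A because
   D = {f_D > 0} on S for every D in A. *)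
Require Import Defs.
From HB Require Import structures.
From mathcomp Require Import all_boot all_order all_algebra.
From mathcomp Require Import all_classical all_reals all_analysis measurable_realfun.

Import Order.TTheory GRing.Theory Num.Theory.
Import numFieldNormedType.Exports.
Local Open Scope classical_set_scope.
Local Open Scope ring_scope.
Local Open Scope ereal_scope.

(** * Countable operations and traces of sigma-fields given as classes of sets *)

Lemma countable_rangeP (I : Type) (D : set I) :
  countable D -> D = set0 \/ exists e : nat -> I, D = range e.
Proof.
move=> /pfcard_geP[->|[e]]; [by left|right].
by exists e; rewrite image_eq.
Qed.

Lemma sigma_algebra_countable_bigcup (I T : Type) (G : set (set T)) (D : set I)
    (F : I -> set T) :
  sigma_algebra setT G -> countable D -> (forall i, D i -> G (F i)) ->
  G (\bigcup_(i in D) F i).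
Proof.
move=> [G0 _ GU] /countable_rangeP[->|[e ->]] GF; first by rewrite bigcup_set0.
by rewrite bigcup_image; apply: GU => n; exact: GF.
Qed.

Lemma negligible_countable_bigcup (d : measure_display) (T : sigmaRingType d)
    (R : realFieldType) (m : {measure set T -> \bar R}) (I : Type) (D : set I)
    (F : I -> set T) :
  countable D -> (forall i, D i -> m.-negligible (F i)) ->
  m.-negligible (\bigcup_(i in D) F i).
Proof.
move=> /countable_rangeP[->|[e ->]] mF.
  by rewrite bigcup_set0; exact: negligible_set0.
by rewrite bigcup_image; apply: negligible_bigcup => n; exact: mF.
Qed.

Lemma countable_image (I J : Type) (f : I -> J) (D : set I) :
  countable D -> countable (f @` D).
Proof. exact: sub_countable (card_image_le f D). Qed.

Lemma countable_setU (T : Type) (A B : set T) :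
  countable A -> countable B -> countable (A `|` B).
Proof.
move=> cA cB; rewrite -(bigcup2E A B).
by apply: bigcup_countable => // -[|[|n]] _ //=; exact: countable0.
Qed.

Lemma sigma_algebraC (T : Type) (G : set (set T)) (A : set T) :
  sigma_algebra setT G -> G A -> G (~` A).
Proof. by move=> [_ GC _] /GC; rewrite setTD. Qed.

Lemma sigma_algebraU (T : pointedType) (G : set (set T)) (A B : set T) :
  sigma_algebra setT G -> G A -> G B -> G (A `|` B).
Proof.
move=> sG; rewrite -(measurable_g_measurableTypeE sG) => mA mB.
exact: measurableU.
Qed.

Lemma sigma_algebraI (T : pointedType) (G : set (set T)) (A B : set T) :
  sigma_algebra setT G -> G A -> G B -> G (A `&` B).
Proof.
move=> sG; rewrite -(measurable_g_measurableTypeE sG) => mA mB.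
exact: measurableI.
Qed.

Lemma sigma_algebraD (T : pointedType) (G : set (set T)) (A B : set T) :
  sigma_algebra setT G -> G A -> G B -> G (A `\` B).
Proof.
by move=> sG GA GB; rewrite setDE; apply: sigma_algebraI => //;
   exact: sigma_algebraC.
Qed.

(** Good sets principle: the sets whose trace on [U] lies in the right-hand side form a sigma-field
    on the whole space containing [G]. *)
Lemma sub_g_sigma_algebra_strace (T : Type) (G : set (set T)) (U : set T) :
  strace <<s G >> U `<=` <<s U, strace G U >>.
Proof.
have [H0 HC HU] := smallest_sigma_algebra U (strace G U).
move=> _ [X GX <-].
suff : <<s G >> `<=` [set X | <<s U, strace G U >> (X `&` U)] by exact.
apply: smallest_sub => [|Y GY /=]; last by apply: sub_sigma_algebra; exists Y.
split => /=.
- by rewrite set0I.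
- move=> Y HY; suff -> : (setT `\` Y) `&` U = U `\` (Y `&` U) by exact: HC.
  by rewrite setTD setDIr setDv setU0 setDE setIC.
- by move=> Y HY; rewrite setI_bigcupl; exact: HU.
Qed.

Lemma measurable_wrtE (T : pointedType) (R : realType) (F : set (set T))
    (g : T -> \bar R) (B : set (\bar R)) :
  sigma_algebra setT F -> measurable_wrt F g -> measurable B -> F (g @^-1` B).
Proof.
move=> sF mg mB; rewrite -(measurable_g_measurableTypeE sF).
by rewrite -[_ @^-1` _]setTI; exact: mg.
Qed.

(** The level sets need only lie in [<<s F >>], so that [F] may be a mere countable class of sets.
    Rational levels suffice because every real level set is a countable union of rational ones. *)
Lemma measurable_wrt_gt_rat (T : pointedType) (R : realType) (F : set (set T))
    (g : T -> \bar R) :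
  (forall q : rat, <<s F >> [set w | (ratr q)%:E < g w]) -> measurable_wrt F g.
Proof.
move=> Fg.
refine (@measurability _ _ (g_sigma_algebraType F) _ _ _
  (@ErealGenOInfty.G R) (ErealGenOInfty.measurableE R) _).
move=> _ [_ [r ->] <-]; rewrite setTI.
have -> : g @^-1` `]r%:E, +oo[ =
    \bigcup_(q in [set q : rat | r < ratr q]%R) [set w | (ratr q)%:E < g w].
  apply/seteqP; split => w /=; rewrite in_itv/= andbT; last first.
    by move=> [q /= rq]; apply: lt_trans; rewrite lte_fin.
  case gw: (g w) => [s||]//.
  - rewrite lte_fin => /rat_in_itvoo[q]; rewrite in_itv/= => /andP[rq qs].
    by exists q => //=; rewrite gw lte_fin.
  - move=> _; have /rat_in_itvoo[q] : (r < r + 1)%R by rewrite ltrDl.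
    by rewrite in_itv/= => /andP[rq _]; exists q => //=; rewrite gw ltry.
by apply: sigma_algebra_countable_bigcup; [exact: smallest_sigma_algebra|
  exact: countableP|move=> q _; exact: Fg].
Qed.

(** * Atoms and regular conditional distributions *)

Lemma atom_subset (T : Type) (A : set (set T)) (D : set T) (w : T) :
  A D -> D w -> atom A w `<=` D.
Proof. by move=> AD Dw x; apply. Qed.

(** The complement of [D] is a member of [A] containing [w], hence includes the atom. With
    [atom_subset] this gives f_D = f on [D] and f_D = 0 off [D]. *)
Lemma atom_disjoint (T : Type) (A : set (set T)) (D : set T) (w : T) :
  sigma_algebra setT A -> A D -> ~ D w -> D `&` atom A w = set0.
Proof.
move=> sA AD nDw; apply/seteqP; split => // x [Dx /(_ (~` D))].
by move=> /(_ (conj (sigma_algebraC _ _ _ sA AD) nDw)).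
Qed.

(* Integrating [1 - mu(D)] over [D `\` [set w | mu w D = 1]] gives [0]. *)
Lemma rcd_eq1_ae (d : measure_display) (T : measurableType d)
    (R : realType) (P : probability T R) (A : set (set T))
    (mu : T -> probability T R) (D : set T) :
  sigma_algebra setT A -> A `<=` @measurable d T ->
  regular_cond_distribution P A mu -> A D ->
  A (D `\` [set w | mu w D = 1]) /\ P.-negligible (D `\` [set w | mu w D = 1]).
Proof.
move=> sA Am rmu AD; have [mumeas muint muE] := rmu _ (Am _ AD).
set V := D `\` _.
have AV : A V.
  apply: sigma_algebraD => //.
  exact: (measurable_wrtE _ _ _ _ [set 1]).
split=> //; have mV := Am _ AV.
pose g w := 1 - mu w D.
have muV : measurable_fun V (fun w => mu w D).
  exact: measurable_funS (measurable_int _ muint).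
have mg : measurable_fun V g by exact: emeasurable_funB.
have g0 w : 0 <= g w.
  by rewrite sube_ge0 ?fin_num_measure//; [exact/probability_le1/Am|exact: Am].
have : \int[P]_(w in V) `|g w| = 0.
  under eq_integral do rewrite gee0_abs//.
  rewrite /g integralB//.
  - rewrite integral_cst// muE// mul1e integral_indic//; last exact: Am.
    rewrite setIidr; last exact: subIsetl.
    by rewrite subee// fin_num_measure.
  - by apply: (integrableS measurableT) => //; exact: finite_measure_integrable_cst.
  - exact: integrableS muint.
move=> /(ae_eq_integral_abs _ mV mg); apply: negligibleS => w Vw /= /(_ Vw).
rewrite /g => /eqP; rewrite sube_eq ?fin_num_adde_defl ?fin_num_measure//.
  by rewrite add0e => /eqP/esym; case: Vw.
exact: Am.
Qed.

Lemma probability_eq1_negligibleC (d : measure_display) (T : measurableType d)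
    (R : realType) (Q : probability T R) (E : set T) :
  measurable E -> Q E = 1 <-> Q.-negligible (~` E).
Proof.
move=> mE; have mC := measurableC mE; split=> [QE|/(measure_negligible mC) QC].
  have QC : Q (~` E) = 0 by rewrite probability_setC// QE subee.
  exact/negligibleP.
by rewrite -(setCK E) probability_setC// QC sube0.
Qed.

Lemma probability_setI1 (d : measure_display) (T : measurableType d)
    (R : realType) (Q : probability T R) (B E : set T) :
  measurable B -> measurable E -> Q E = 1 -> Q (B `&` E) = Q B.
Proof.
move=> mB mE /(probability_eq1_negligibleC _ _ _ _ _ mE) nE.
apply: esym; rewrite -[in LHS](setUIDK B E) measureU//=.
- rewrite [X in _ + X](_ : _ = 0) ?adde0//.
  apply: measure_negligible; first exact: measurableD.
  by apply: negligibleS nE => x [].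
- exact: measurableI.
- exact: measurableD.
- by apply/seteqP; split => // x [[_ ?] []].
Qed.

(** Dynkin's pi-lambda argument: for fixed w, B |-> f_B(w) is a finite measure, so complements
    become differences from f and disjoint unions become series. *)
Lemma atom_mass_measurable_wrt (d : measure_display) (T : measurableType d)
    (R : realType) (A : set (set T)) (mu : T -> probability T R)
    (G F : set (set T)) :
  (forall w, measurable (atom A w)) ->
  @measurable d T = <<s G >> -> setI_closed G ->
  measurable_wrt F (atom_mass A mu setT) ->
  (forall B, G B -> measurable_wrt F (atom_mass A mu B)) ->
  forall B, measurable B -> measurable_wrt F (atom_mass A mu B).
Proof.
move=> mH mG GI FT FG B; rewrite mG; move: B.
apply: (@dynkin_induction _ _ _ _ mG GI) => //.
- move=> B mB FB; rewrite /measurable_wrt.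
  have -> : atom_mass A mu (~` B) =
      (fun w => atom_mass A mu setT w - atom_mass A mu B w).
    apply/funext => w; rewrite /atom_mass setTI setIC -setDE measureD//.
      by rewrite setIC.
    by rewrite ltey_eq fin_num_measure.
  exact: emeasurable_funB.
- move=> B mB tB FB; rewrite /measurable_wrt.
  have -> : atom_mass A mu (\bigcup_k B k) =
      (fun w => \sum_(0 <= k <oo | k \in setT) atom_mass A mu (B k) w).
    apply/funext => w; rewrite /atom_mass setI_bigcupl measure_bigcup//.
    + by move=> i _; exact: measurableI.
    + exact: trivIset_setIr.
  refine (@ge0_emeasurable_sum _ (g_sigma_algebraType F) R setT
    (fun k => atom_mass A mu (B k)) (fun k => k \in setT) _ _).
  - by move=> k w _ _; exact: measure_ge0.
  - by move=> k _; exact: FB.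
Qed.

(** * Full mass of the atoms where the trace is countably generated *)

Lemma atom_mass1_ae (d : measure_display) (T : measurableType d) (R : realType)
    (P : probability T R) (A : set (set T)) (mu : T -> probability T R)
    (U : set T) :
  sigma_algebra setT A -> A `<=` @measurable d T ->
  regular_cond_distribution P A mu -> (forall w, measurable (atom A w)) ->
  A U -> countably_generated U (strace A U) ->
  exists U0 : set T, [/\ A U0, U0 `<=` U, P (U `\` U0) = 0 &
    forall w, U0 w -> atom_mass A mu setT w = 1].
Proof.
move=> sA Am rmu mH AU [C [cC CA AUE]].
pose F := [set U] `|` (C `|` [set U `\` E | E in C]).
have cF : countable F.
  by do ?apply: countable_setU => //; exact: countable_image.
have FA E : F E -> A E.
  have CAE X : C X -> A X by move=> /CA[Y AY <-]; exact: sigma_algebraI.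
  move=> [->//|[/CAE//|[X /CAE AX <-]]]; exact: sigma_algebraD.
pose bad (E : set T) := E `\` [set w | mu w E = 1].
(* Off this single null set, [mu w E = 1] holds simultaneously for all [E] in [F] containing [w]. *)
pose N := \bigcup_(E in F) bad E.
have AN : A N.
  apply: sigma_algebra_countable_bigcup => // E /FA AE.
  by case: (rcd_eq1_ae _ _ _ P _ _ _ sA Am rmu AE).
have PN : P.-negligible N.
  apply: negligible_countable_bigcup => // E /FA AE.
  by case: (rcd_eq1_ae _ _ _ P _ _ _ sA Am rmu AE).
exists (U `\` N); split.
- exact: sigma_algebraD.
- exact: subDsetl.
- apply: measure_negligible.
    by apply: Am; do 2?apply: sigma_algebraD.
  by apply: negligibleS PN => x [Ux nUN]; apply: contrapT => nN; exact: nUN.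
move=> w [Uw nNw].
have mu1 E : F E -> E w -> mu w E = 1.
  by move=> FE Ew; apply: contrapT => mE; apply: nNw; exists E.
rewrite /atom_mass setTI; apply/probability_eq1_negligibleC => //.
pose K := \bigcap_(E in [set E | F E /\ E w]) E.
have KH : K `<=` atom A w.
  (* No trace set splits [K]. Both halves are proved together because complementation in [U]
     exchanges them. *)
  suff AK D : strace A U D -> (D w -> K `<=` D) /\ (~ D w -> K `&` D = set0).
    move=> x Kx D [AD Dw].
    have [] := AK (D `&` U); first by exists D.
    by move=> /(_ (conj Dw Uw) x Kx)[].
  have KU : K `<=` U by move=> x; apply; split=> //; left.
  rewrite AUE; move: D.
  apply: smallest_sub; last first.
    move=> E CE; split=> [Ew x|nEw]; first by apply; split=> //; right; left.
    rewrite -subset0 => x [Kx Ex].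
    suff [] : (U `\` E) x by [].
    by apply: Kx; split=> //; right; right; exists E.
  split => /=.
  - by split=> // _; rewrite setI0.
  - move=> D [DK nDK]; split=> [[_ /nDK KD x Kx]|nUD].
      by split; [exact: KU|move=> Dx; suff : set0 x by []; rewrite -KD].
    have Dw : D w by apply: contrapT => nDw; exact: nUD.
    by rewrite -subset0 => x [/(DK Dw) ? []].
  - move=> D DK; split=> [[k _ Dw] x Kx|nD].
      by exists k => //; exact: (DK k).1.
    rewrite -subset0 => x [Kx [k _ Dx]].
    rewrite -((DK k).2 _); first by split.
    by move=> Dw; apply: nD; exists k.
(* The complement of [K] is a countable union of [mu w]-null sets, and it includes the complement of
   the atom. *)
have : (mu w).-negligible (\bigcup_(E in [set E | F E /\ E w]) ~` E).
  apply: negligible_countable_bigcup => [|E [FE Ew]].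
    by apply: sub_countable cF; apply: subset_card_le => E [].
  by apply/probability_eq1_negligibleC; [exact/Am/FA|exact: mu1].
by apply: negligibleS; rewrite -setC_bigcap; exact: subsetC.
Qed.

(** * From (3) to (a) *)

Lemma atom_mass_le (d : measure_display) (T : measurableType d) (R : realType)
    (A : set (set T)) (mu : T -> probability T R) (B : set T) (w : T) :
  measurable B -> measurable (atom A w) -> atom_mass A mu B w <= mu w (atom A w).
Proof.
move=> mB mH; apply: le_measure; rewrite ?inE//; exact: measurableI.
Qed.

(** On S within [A0], f is positive, hence 1, and {f_B > q} coincides with {mu(.)(B) > q}; off S,
    f_B = 0 and the level set is everything or nothing according to the sign of q. *)
Lemma atom_mass_completion_measurable (d : measure_display)
    (T : measurableType d) (R : realType) (P : probability T R)
    (A : set (set T)) (mu : T -> probability T R) (A0 B : set T) :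
  sigma_algebra setT A -> A `<=` @measurable d T ->
  regular_cond_distribution P A mu -> (forall w, measurable (atom A w)) ->
  completion P A (atom_support A mu) -> A A0 -> P A0 = 1 ->
  (forall w, A0 w -> mu w (atom A w) = 0 \/ mu w (atom A w) = 1) ->
  measurable B -> measurable_wrt (completion P A) (atom_mass A mu B).
Proof.
move=> sA Am rmu mH [S1 [S2 [AS1 AS2 S1S SS2 PS]]] AA0 PA0 A001 mB.
apply: measurable_wrt_gt_rat => q; apply: sub_sigma_algebra.
have [mumeas _ _] := rmu _ mB.
pose G := [set w | (ratr q)%:E < mu w B].
have AG : A G.
  have -> : G = (fun w => mu w B) @^-1` `](ratr q)%:E, +oo[.
    by apply/seteqP; split => w /=; rewrite in_itv/= andbT.
  by apply: measurable_wrtE => //; exact: emeasurable_itv.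
pose Z := [set _ : T | (ratr q)%:E < 0 :> \bar R].
have AZ : A Z.
  have [A0' AC _] := sA.
  have [q0|q0] := pselect ((ratr q)%:E < 0 :> \bar R).
    suff -> : Z = ~` set0 by exact: sigma_algebraC.
    by rewrite setC0; apply/seteqP; split.
  by suff -> : Z = set0 by []; apply/seteqP; split.
have fS w : A0 w -> atom_support A mu w -> atom_mass A mu B w = mu w B.
  move=> Aw; rewrite /atom_support /= /atom_mass setTI => Sw.
  apply: probability_setI1 => //.
  by have [H0|//] := A001 w Aw; rewrite H0 ltxx in Sw.
have fN w : ~ atom_support A mu w -> atom_mass A mu B w = 0.
  rewrite /atom_support /= {1}/atom_mass setTI => /negP; rewrite -leNgt => Sw.
  apply/eqP; rewrite eq_le measure_ge0 andbT; apply: le_trans Sw.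
  exact: atom_mass_le.
(* S is only known up to [S1] and [S2]: [L] describes the level set where membership in S is decided
   by them, and the null set [M] absorbs the remaining points. *)
pose L := A0 `&` ((S1 `&` G) `|` (Z `\` S2)).
pose M := ~` A0 `|` (S2 `\` S1).
have AL : A L.
  apply: sigma_algebraI => //; apply: sigma_algebraU => //.
    exact: sigma_algebraI.
  exact: sigma_algebraD.
have AM : A M.
  apply: sigma_algebraU => //; first exact: sigma_algebraC.
  exact: sigma_algebraD.
exists L, (L `|` M); split => //.
- exact: sigma_algebraU.
- move=> w [A0w [[S1w Gw]|[Zw nS2w]]] /=.
    by rewrite fS//; exact: S1S.
  by rewrite fN// => /SS2.
- move=> w /= qw.
  have [A0w|nA0w] := pselect (A0 w); last by right; left.
  have [S2w|nS2w] := pselect (S2 w); last first.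
    left; split=> //; right; split=> //.
    by move: qw; rewrite fN// => /SS2.
  have [S1w|nS1w] := pselect (S1 w); last by right; right.
  left; split=> //; left; split=> //.
  by move: qw; rewrite fS//; exact: S1S.
- apply: measure_negligible.
    by apply: Am; apply: sigma_algebraD => //; exact: sigma_algebraU.
  apply: (@negligibleS _ _ _ _ M); first by move=> w [[]].
  apply: negligibleU; first exact/probability_eq1_negligibleC/PA0/Am.
  by apply/negligibleP => //; apply: Am; exact: sigma_algebraD.
Qed.

(** * From (a) to (b) *)

Lemma atom_mass_countably_generated (d : measure_display)
    (T : measurableType d) (R : realType) (P : probability T R)
    (A : set (set T)) (mu : T -> probability T R) :
  countably_generated setT (@measurable d T) ->
  sigma_algebra setT A -> A `<=` @measurable d T ->
  (forall w, measurable (atom A w)) ->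
  completion P A (atom_support A mu) ->
  (forall B, measurable B ->
    measurable_wrt (completion P A) (atom_mass A mu B)) ->
  exists U : set T, [/\ A U, U `<=` atom_support A mu,
    completion_prob P A (atom_support A mu `\` U) = 0 &
    countably_generated U (strace A U)].
Proof.
move=> [C [cC Cm mC]] sA Am mH [S1 [S2 [AS1 AS2 S1S SS2 PS]]] mf.
have sP := completion_sigma_algebra P sA Am.
pose G := finI_from C idfun.
(* The empty intersection puts the whole space in [G], so the level sets of f itself are among those
   in [E]. *)
have GT : G setT by exists finmap.fset0 => //; rewrite set_fset0 bigcap_set0.
have mG : @measurable d T = <<s G >>.
  apply/seteqP; split.
    rewrite mC; apply: smallest_sub; first exact: smallest_sigma_algebra.
    by move=> X CX; apply: sub_sigma_algebra; exact: (finI_from1 idfun CX).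
  apply: smallest_sub; first exact: sigma_algebra_measurable.
  move=> _ [D DC <-]; apply: fin_bigcap_measurable => // X DX.
  by apply: Cm; have := DC X DX; rewrite inE.
pose E := [set [set w | (ratr p.2)%:E < atom_mass A mu p.1 w] |
            p in G `*` [set: rat]].
have cE : countable E.
  by apply/countable_image/countableX; [exact: finI_from_countable|].
have EP X : E X -> completion P A X.
  move=> [[B q] [/= GB _] <-].
  have -> : [set w | (ratr q)%:E < atom_mass A mu B w] =
      atom_mass A mu B @^-1` `](ratr q)%:E, +oo[.
    by apply/seteqP; split => w /=; rewrite in_itv/= andbT.
  apply: measurable_wrtE => //; last exact: emeasurable_itv.
  by apply: mf; rewrite mG; exact: sub_sigma_algebra.
(* Choice needs a total function, hence the dummy pair of empty sets outside [E]. *)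
have /choice[lh lhP] : forall X, exists lh : set T * set T, E X ->
    [/\ A lh.1, A lh.2, lh.1 `<=` X, X `<=` lh.2 & P (lh.2 `\` lh.1) = 0].
  move=> X; have [/EP[lo [hi ?]]|?] := pselect (E X); first by exists (lo, hi).
  by exists (set0, set0).
pose N := \bigcup_(X in E) ((lh X).2 `\` (lh X).1).
have AN : A N.
  apply: sigma_algebra_countable_bigcup => // X /lhP[? ? _ _ _].
  exact: sigma_algebraD.
have PN : P.-negligible N.
  apply: negligible_countable_bigcup => // X /lhP[? ? _ _ PX].
  by apply/negligibleP => //; apply: Am; exact: sigma_algebraD.
pose U := S1 `\` N.
have AU : A U by exact: sigma_algebraD.
have US : U `<=` atom_support A mu by move=> x [/S1S].
exists U; split => //.
  have [A0 _ _] := sA.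
  have AS2U : A (S2 `\` U) by exact: sigma_algebraD.
  rewrite (@completion_probE _ _ _ _ _ _ set0 (S2 `\` U)) ?measure0//.
    by move=> x [/SS2].
  rewrite setD0; apply: measure_negligible; first exact: Am.
  apply: (@negligibleS _ _ _ _ ((S2 `\` S1) `|` N)).
    move=> x [S2x nUx]; have [Nx|nNx] := pselect (N x); [by right|left].
    by split=> // S1x; exact: nUx.
  apply: negligibleU PN.
  by apply/negligibleP => //; apply: Am; exact: sigma_algebraD.
(* The gap between the two bounds of [X] lies in [N], so on [U] the set [X] agrees with its lower
   bound, a member of [A]. *)
have EU X : E X -> X `&` U = (lh X).1 `&` U.
  move=> EX; have [_ _ loX Xhi _] := lhP X EX.
  apply/seteqP; split=> x [Xx Ux]; split=> //; last exact: loX.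
  apply: contrapT => nlo; have [_ nN] := Ux; apply: nN; exists X => //.
  by split=> //; exact: Xhi.
have EUA : strace E U `<=` strace A U.
  by move=> _ [X EX <-]; rewrite EU//; exists (lh X).1 => //; case: (lhP X EX).
exists (strace E U); split => //; first exact: countable_image.
apply/seteqP; split; last first.
  by apply: smallest_sub => //; exact: sigma_algebra_strace.
move=> _ [D AD <-]; apply: sub_g_sigma_algebra_strace.
(* Measurability is taken with respect to the countable class [E] rather than the completion, so
   that preimages land in [<<s E >>]. *)
have mE B : G B -> measurable_wrt E (atom_mass A mu B).
  move=> GB; apply: measurable_wrt_gt_rat => q; apply: sub_sigma_algebra.
  by exists (B, q).
(* On [U], where f > 0, the set {f_D > 0} is exactly [D]. *)
exists (atom_mass A mu D @^-1` `]0, +oo[).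
  have : measurable_wrt E (atom_mass A mu D).
    apply: (@atom_mass_measurable_wrt _ _ _ _ _ G) => //.
    - by move=> X Y; exact: finI_fromI.
    - exact: mE.
    - exact: Am.
  by move=> mD; rewrite -[_ @^-1` _]setTI; apply: mD => //; exact: emeasurable_itv.
apply/seteqP; split=> x [Dx Ux]; split=> //.
  apply: contrapT => nDx; move: Dx => /=.
  by rewrite /atom_mass atom_disjoint// measure0 in_itv/= ltxx.
rewrite /= in_itv/= andbT /atom_mass setIidr; last exact: atom_subset.
by have := US x Ux; rewrite /atom_support/= /atom_mass setTI.
Qed.

(** From (b) to (3): f vanishes off [S2], and f = 1 on the set [U0] supplied by [atom_mass1_ae].
    What is left lies in the union of the null sets [S2] - [S1], [S1] - [U] and [U] - [U0]. *)
Lemma atom_mass_01_ae (d : measure_display) (T : measurableType d)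
    (R : realType) (P : probability T R) (A : set (set T))
    (mu : T -> probability T R) (U : set T) :
  sigma_algebra setT A -> A `<=` @measurable d T ->
  regular_cond_distribution P A mu -> (forall w, measurable (atom A w)) ->
  completion P A (atom_support A mu) ->
  A U -> completion_prob P A (atom_support A mu `\` U) = 0 ->
  countably_generated U (strace A U) ->
  exists A0 : set T, [/\ A A0, P A0 = 1 &
    forall w, A0 w -> mu w (atom A w) = 0 \/ mu w (atom A w) = 1].
Proof.
move=> sA Am rmu mH [S1 [S2 [AS1 AS2 S1S SS2 PS]]] AU PSU cU.
have [U0 [AU0 U0U PU0 f1]] := atom_mass1_ae _ _ _ _ _ _ _ sA Am rmu mH AU cU.
have AA0 : A (~` S2 `|` U0).
  by apply: sigma_algebraU => //; exact: sigma_algebraC.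
exists (~` S2 `|` U0); split => //.
- apply/probability_eq1_negligibleC; first exact: Am.
  apply: (@negligibleS _ _ _ _
    ((S2 `\` S1) `|` ((S1 `\` U) `|` (U `\` U0)))).
    move=> x nx.
    have S2x : S2 x by apply: contrapT => n2; apply: nx; left.
    have nU0 : ~ U0 x by move=> ?; apply: nx; right.
    have [S1x|] := pselect (S1 x); last by left.
    have [Ux|] := pselect (U x); last by right; left.
    by right; right.
  apply: negligibleU.
    by apply/negligibleP => //; apply: Am; exact: sigma_algebraD.
  apply: negligibleU; last first.
    by apply/negligibleP => //; apply: Am; exact: sigma_algebraD.
  have AS1U : A (S1 `\` U) by exact: sigma_algebraD.
  apply/negligibleP; first exact: Am.
  (* Since [S1] - [U] is included in S - [U], its probability is a lower bound of the set whose
     infimum is [completion_prob]. *)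
  apply/eqP; rewrite eq_le measure_ge0 andbT -PSU.
  apply: le_ereal_inf_tmp => _ [Y [AY SUY] <-].
  apply: le_measure; rewrite ?inE; [exact: Am|exact: Am|].
  by apply: subset_trans SUY; exact: setSD.
- move=> w [nS2w|/f1]; last by rewrite /atom_mass setTI; right.
  left; apply/eqP; rewrite eq_le measure_ge0 andbT leNgt; apply/negP => H0.
  by apply/nS2w/SS2; rewrite /atom_support/= /atom_mass setTI.
Qed.

Theorem theorem3 (d : measure_display) (T : measurableType d) (R : realType)
    (P : probability T R) (A : set (set T)) (mu : T -> probability T R)
    (B_cg : countably_generated setT (@measurable d T))
    (A_sigma : sigma_algebra setT A)
    (A_sub : A `<=` @measurable d T)
    (mu_rcd : regular_cond_distribution P A mu)
    (H_meas : forall w : T, measurable (atom A w)) :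
  (forall U : set T, A U -> countably_generated U (strace A U) ->
     exists U0 : set T, [/\ A U0, U0 `<=` U, P (U `\` U0) = 0 &
       forall w, U0 w -> atom_mass A mu setT w = 1])
  /\
  (completion P A (atom_support A mu) ->
     let cond3 := exists A0 : set T, [/\ A A0, P A0 = 1 &
       forall w, A0 w -> mu w (atom A w) = 0 \/ mu w (atom A w) = 1] in
     (cond3 <->
        (forall B : set T, measurable B ->
           measurable_wrt (completion P A) (atom_mass A mu B)))
     /\
     (cond3 <->
        (exists U : set T, [/\ A U, U `<=` atom_support A mu,
           completion_prob P A (atom_support A mu `\` U) = 0 &
           countably_generated U (strace A U)]))).
Proof.
split; first by move=> U; exact: atom_mass1_ae.
move=> mS cond3.
have a_of_3 : cond3 -> forall B, measurable B ->
    measurable_wrt (completion P A) (atom_mass A mu B).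
  move=> [A0 [AA0 PA0 f01]] B.
  exact: (atom_mass_completion_measurable _ _ _ _ _ _ A0).
have b_of_a := atom_mass_countably_generated _ _ _ P A mu B_cg A_sigma A_sub
  H_meas mS.
have three_of_b : (exists U : set T, [/\ A U, U `<=` atom_support A mu,
    completion_prob P A (atom_support A mu `\` U) = 0 &
    countably_generated U (strace A U)]) -> cond3.
  by move=> [U [AU _ PSU cU]]; exact: (atom_mass_01_ae _ _ _ P _ _ U).
by split; split=> //; [move=> /b_of_a/three_of_b|move=> /a_of_3/b_of_a].
Qed.
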